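(* Let $G$ be a Lie group with a left-invariant semi-Riemannian metric $g$. Let $(e_i)$, $(\hat e_i)$ be two vector bases of $\mathfrak{g}=T_1G$ and let $h,\hat h$ be the Clairaut metrics associated to $g$ from them, respectively. Then $h$ and $\hat h$ are bi-Lipschitz bounded (i.e. there is a constant $c>0$ such that $c\,h\le \hat h\le h/c$) and, in particular, they induce uniformly equivalent distances on $G$. Moreover, if the transition matrix $M$ between $(e_i)$ and $(\hat e_i)$ (given by $\hat e_j=\sum_i M^i_j e_i$) is orthonormal (i.e. $M^T M=\mathrm{I}$), then $h=\hat h$.
   Context: A semi-Riemannian metric is a smooth non-degenerate symmetric 2-tensor field of constant (arbitrary) signature. Given a left-invariant semi-Riemannian metric $g$ on $G$ and a basis $(e_i)$ of $\mathfrak{g}=T_1G$, let $Y_i$ be the right-invariant vector field on $G$ with $Y_i(1)=e_i$ and let $\omega^i=g(Y_i,\cdot)$ be its $g$-dual 1-form. The Clairaut metric associated to $g$ from the basis $(e_i)$ is the Riemannian metric $h=\sum_i\omega^i\otimes\omega^i$ on $G$. *)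

(* Defs.v *)
From HB Require Import structures.
From mathcomp Require Import all_boot all_order all_algebra.
From mathcomp Require Import all_classical all_reals all_analysis.

Set Implicit Arguments.
Unset Strict Implicit.
Unset Printing Implicit Defensive.

Import Order.TTheory GRing.Theory Num.Theory.
Import numFieldNormedType.Exports.

Local Open Scope classical_set_scope.
Local Open Scope ring_scope.

(* C^k on an open set U, by iterated Frechet differentials. In finite dimension
   x |-> 'd f x is C^k iff x |-> 'd f x v is C^k for every fixed v, which avoids
   having to put a norm on the space of linear maps. *)
Fixpoint Ck_on (R : realType) (V W : normedModType R) (k : nat) (U : set V)
    (f : V -> W) : Prop :=
  match k with
  | 0 => forall x, U x -> {for x, continuous f}
  | k'.+1 => (forall x, U x -> differentiable f x) /\
             (forall v, Ck_on k' U (fun x => 'd f x v))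
  end.

Definition smooth_on (R : realType) (V W : normedModType R) (U : set V)
    (f : V -> W) : Prop :=
  forall k, Ck_on k U f.

Definition smooth_at (R : realType) (V W : normedModType R) (f : V -> W)
    (x : V) : Prop :=
  exists2 U : set V, open_nbhs x U & smooth_on U f.

Record chart (R : realType) (n : nat) (M : topologicalType) := Chart {
  chart_source : set M;
  chart_fun :> M -> 'rV[R]_n;
  chart_inv : 'rV[R]_n -> M;
  chart_source_open : open chart_source;
  chart_target_open : open (chart_fun @` chart_source);
  chart_funK : forall p, chart_source p -> chart_inv (chart_fun p) = p;
  chart_fun_continuous :
    forall p, chart_source p -> {for p, continuous chart_fun};
  chart_inv_continuous :
    forall x, (chart_fun @` chart_source) x -> {for x, continuous chart_inv}
}.

(* [chart_at p] is a chosen chart of the atlas around p; it serves only to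
   represent tangent vectors at p by their coordinates. *)
HB.mixin Record isSmoothManifold (R : realType) (n : nat) M
    of Topological M := {
  atlas : set (chart R n M);
  chart_at : M -> chart R n M;
  chart_at_atlas : forall p, atlas (chart_at p);
  chart_at_source : forall p, chart_source (chart_at p) p;
  atlas_smooth : forall phi psi, atlas phi -> atlas psi ->
    smooth_on (phi @` (chart_source phi `&` chart_source psi))
              (psi \o chart_inv phi);
  manifold_hausdorff : hausdorff_space M;
  manifold_second_countable : @second_countable M
}.

#[short(type="smoothManifoldType")]
HB.structure Definition SmoothManifold (R : realType) (n : nat) :=
  { M of isSmoothManifold R n M & Topological M }.

Arguments chart_at {R n s} p : rename.

Definition smooth_map_at (R : realType) (m n : nat)
    (M : smoothManifoldType R m) (N : smoothManifoldType R n)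
    (F : M -> N) (p : M) : Prop :=
  {for p, continuous F} /\
  smooth_at (chart_at (F p) \o F \o chart_inv (chart_at p)) (chart_at p p).

(* Smoothness of the multiplication is read in the product charts
   [chart_at p] x [chart_at q] of G x G, with values in R^(n + n). *)
HB.mixin Record isLieGroup (R : realType) (n : nat) G
    of SmoothManifold R n G & Group G := {
  mulg_continuous : continuous (fun z : G * G => (z.1 * z.2)%g);
  mulg_smooth : forall p q : G,
    smooth_at
      (fun z : 'rV[R]_(n + n) =>
         chart_at (p * q)%g
           (chart_inv (chart_at p) (lsubmx z) *
            chart_inv (chart_at q) (rsubmx z))%g)
      (row_mx (chart_at p p) (chart_at q q));
  invg_smooth : forall p : G, smooth_map_at (fun x : G => x^-1%g) p
}.

#[short(type="lieGroupType")]
HB.structure Definition LieGroup (R : realType) (n : nat) :=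
  { G of isLieGroup R n G & SmoothManifold R n G & Group G }.

(* A tangent vector at p is given by its coordinates in [chart_at p]. *)
Definition tangent (R : realType) (n : nat) (M : smoothManifoldType R n)
    (p : M) : Type := 'rV[R]_n.

HB.instance Definition _ (R : realType) (n : nat) (M : smoothManifoldType R n)
  (p : M) := Vector.on (@tangent R n M p).

Definition tangent_map (R : realType) (m n : nat)
    (M : smoothManifoldType R m) (N : smoothManifoldType R n)
    (F : M -> N) (p : M) (v : tangent p) : tangent (F p) :=
  'd (chart_at (F p) \o F \o chart_inv (chart_at p)) (chart_at p p) v.

(* The value at p of the vector field whose coordinates in the chart phi are
   constantly equal to u. *)
Definition coord_field (R : realType) (n : nat) (M : smoothManifoldType R n)
    (phi : chart R n M) (u : 'rV[R]_n) (p : M) : tangent p :=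
  'd (chart_at p \o chart_inv phi) (phi p) u.

Definition tensor2 (R : realType) (n : nat) (M : smoothManifoldType R n) :=
  forall p : M, tangent p -> tangent p -> R.

Definition smooth_tensor2 (R : realType) (n : nat) (M : smoothManifoldType R n)
    (g : tensor2 M) : Prop :=
  forall (phi : chart R n M) (u w : 'rV[R]_n), atlas phi ->
    smooth_on (phi @` chart_source phi)
      (fun x => let p := chart_inv phi x in
                g p (coord_field phi u p) (coord_field phi w p)).

(* g is symmetric, bilinear at every point, smooth, non-degenerate, and has the
   same number q of negative squares at every point. *)
Definition semi_riemannian (R : realType) (n : nat)
    (M : smoothManifoldType R n) (g : tensor2 M) : Prop :=
  [/\ forall (p : M) (v w : tangent p), g p v w = g p w v,
      forall (p : M) (a : R) (v w z : tangent p),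
        g p z (a *: v + w) = a * g p z v + g p z w,
      smooth_tensor2 g,
      forall (p : M) (v : tangent p),
        (forall w : tangent p, g p v w = 0) -> v = 0 &
      exists q : nat, forall p : M, exists b : n.-tuple (tangent p),
        basis_of fullv b /\
        forall i j : 'I_n, g p (tnth b i) (tnth b j) =
          (if i == j then (if (i < q)%N then -1 else 1) else 0)].

Definition left_invariant (R : realType) (n : nat) (G : lieGroupType R n)
    (g : tensor2 G) : Prop :=
  forall (a p : G) (v w : tangent p),
    g (a * p)%g (tangent_map (fun x : G => (a * x)%g) v)
                (tangent_map (fun x : G => (a * x)%g) w) = g p v w.

(* The translation x |-> x * p maps 1 to 1 * p; the cast from [tangent (1 * p)]
   to [tangent p] is a conversion, and both use the same chart since
   1 * p = p. *)
Definition right_invariant_field (R : realType) (n : nat)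
    (G : lieGroupType R n) (e : tangent (1%g : G)) (p : G) : tangent p :=
  tangent_map (fun x : G => (x * p)%g) e.

Definition clairaut_form (R : realType) (n : nat) (G : lieGroupType R n)
    (g : tensor2 G) (e : tangent (1%g : G)) (p : G) (v : tangent p) : R :=
  g p (right_invariant_field e p) v.

Definition clairaut (R : realType) (n : nat) (G : lieGroupType R n)
    (g : tensor2 G) (e : n.-tuple (tangent (1%g : G))) : tensor2 G :=
  fun p v w =>
    \sum_(i < n) clairaut_form g (tnth e i) v * clairaut_form g (tnth e i) w.

Definition bilipschitz_bounded (R : realType) (n : nat)
    (M : smoothManifoldType R n) (h h' : tensor2 M) : Prop :=
  exists2 c : R, 0 < c & forall (p : M) (v : tangent p),
    c * h p v v <= h' p v v <= h p v v / c.

Definition smooth_curve_at (R : realType) (n : nat)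
    (M : smoothManifoldType R n) (c : R -> M) (t : R) : Prop :=
  {for t, continuous c} /\ smooth_at (chart_at (c t) \o c) t.

Definition velocity (R : realType) (n : nat) (M : smoothManifoldType R n)
    (c : R -> M) (t : R) : tangent (c t) :=
  derive1 (chart_at (c t) \o c) t.

(* c is continuous on [0, 1] and, for some subdivision
   0 = s_0 < s_1 < ... < s_k = 1, it agrees on each [s_i, s_(i+1)] with a curve
   that is smooth on a neighbourhood of this closed interval. *)
Definition piecewise_smooth (R : realType) (n : nat)
    (M : smoothManifoldType R n) (c : R -> M) : Prop :=
  {within `[0, 1], continuous c} /\
  exists s : seq R, [/\ path <%R 0 s, last 0 s = 1 &
    forall i, (i < size s)%N -> exists c' : R -> M,
      forall t, nth 0 (0 :: s) i <= t <= nth 0 s i ->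
        smooth_curve_at c' t /\ c t = c' t].

Definition curve_length (R : realType) (n : nat) (M : smoothManifoldType R n)
    (h : tensor2 M) (c : R -> M) : \bar R :=
  (\int[lebesgue_measure]_(t in `[0%R, 1%R])
     (Num.sqrt (h (c t) (velocity c t) (velocity c t)))%:E)%E.

(* +oo between points in different connected components. *)
Definition riemannian_dist (R : realType) (n : nat)
    (M : smoothManifoldType R n) (h : tensor2 M) (p q : M) : \bar R :=
  ereal_inf [set curve_length h c | c in
    [set c : R -> M | [/\ piecewise_smooth c, c 0 = p & c 1 = q]]].

Definition uniformly_finer (R : realType) (T : Type) (d d' : T -> T -> \bar R)
    : Prop :=
  forall eps : R, 0 < eps -> exists2 delta : R, 0 < delta &
    forall p q, (d p q < delta%:E)%E -> (d' p q < eps%:E)%E.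

Definition uniformly_equivalent (R : realType) (T : Type)
    (d d' : T -> T -> \bar R) : Prop :=
  uniformly_finer d d' /\ uniformly_finer d' d.

(* Main.v *)
Require Import Defs.
From HB Require Import structures.
From mathcomp Require Import all_boot all_order all_algebra.
From mathcomp Require Import all_classical all_reals all_analysis.
From mathcomp Require Import ring lra.
Import Order.TTheory GRing.Theory Num.Theory.
Import numFieldNormedType.Exports.
Local Open Scope ring_scope.
Set Implicit Arguments.
Unset Strict Implicit.

(** The Clairaut metric at p is the Euclidean square of the covector tuple
    W(v) = (omega^1(v), ..., omega^n(v)), i.e. h(v, w) = W(v) W(w)^T. The field
    Y_i is the image of e_i under the differential of a right translation, which
    is linear, and g is bilinear; so omega^i depends linearly on e_i. A change
    of basis with matrix M therefore multiplies every row W(v) by the same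
    constant matrix M, whatever the point p ([clairaut_row_transition]).

    When M is orthonormal, the factor M M^T in the middle of W M M^T W^T
    disappears and the two metrics coincide. In general, the Cauchy-Schwarz
    inequality bounds |W M|^2 by the squared Frobenius norm of M times |W|^2
    ([mulmx_sqr_le]); since that constant is independent of the point and of
    the vector, h' <= K h, and exchanging the bases gives the other bound.

    A bound h' <= K h multiplies the length of each curve by at most sqrt K,
    hence the infimum of lengths too, which makes the distances uniformly
    comparable. The two lengths are compared through the definition of the
    integral of a nonnegative function as a supremum over simple functions,
    which is monotone and homogeneous for arbitrary nonnegative functions,
    measurable or not
    ([ge0_le_integral_scale]). *)

(** * Row vectors and the Cauchy-Schwarz inequality *)

(** Lagrange's identity: the defect in the inequality is half the sum of the
    squares (u i * a k - u k * a i)^2. *)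
Lemma sum_cauchy_schwarz (R : realFieldType) (n : nat) (u a : 'I_n -> R) :
  (\sum_i u i * a i) ^+ 2 <= (\sum_i u i ^+ 2) * (\sum_i a i ^+ 2).
Proof.
have : 0 <= \sum_i \sum_k (u i * a k - u k * a i) ^+ 2.
  by apply: sumr_ge0 => i _; apply: sumr_ge0 => k _; exact: sqr_ge0.
suff -> : \sum_i \sum_k (u i * a k - u k * a i) ^+ 2 =
    ((\sum_i u i ^+ 2) * (\sum_i a i ^+ 2) - (\sum_i u i * a i) ^+ 2) *+ 2.
  by rewrite pmulrn_lge0// subr_ge0.
have sumM (f h : 'I_n -> R) :
    (\sum_i f i) * (\sum_k h k) = \sum_i \sum_k f i * h k.
  by rewrite mulr_suml; apply: eq_bigr => i _; rewrite mulr_sumr.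
rewrite mulrnBl mulr2n {2}[_ * (\sum_i a i ^+ 2)]mulrC expr2 !sumM.
rewrite -sumrMnl -big_split -sumrB; apply: eq_bigr => i _ /=.
rewrite -sumrMnl -big_split -sumrB; apply: eq_bigr => k _ /=.
ring.
Qed.

Lemma mulmx_trE (R : pzSemiRingType) (n : nat) (u v : 'rV[R]_n) :
  (u *m v^T) 0 0 = \sum_i u 0 i * v 0 i.
Proof. by rewrite mxE; apply: eq_bigr => i _; rewrite mxE. Qed.

(** The operator norm of a matrix is at most its Frobenius norm. *)
Lemma mulmx_sqr_le (R : realFieldType) (m n : nat) (A : 'M[R]_(m, n))
    (u : 'rV[R]_m) :
  \sum_j (u *m A) 0 j ^+ 2 <=
  (\sum_j \sum_i A i j ^+ 2) * (\sum_i u 0 i ^+ 2).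
Proof.
rewrite mulr_suml; apply: ler_sum => j _; rewrite mxE mulrC.
exact: sum_cauchy_schwarz.
Qed.

(** * Clairaut metrics and changes of basis *)

Definition clairaut_row {R : realType} {n : nat} {G : lieGroupType R n}
    (g : tensor2 G) (e : n.-tuple (tangent (1%g : G))) (p : G)
    (v : tangent p) : 'rV[R]_n :=
  \row_i clairaut_form g (tnth e i) v.

Arguments clairaut_row {R n G} g e {p} v.

Lemma clairautE (R : realType) (n : nat) (G : lieGroupType R n)
    (g : tensor2 G) (e : n.-tuple (tangent (1%g : G))) (p : G)
    (v w : tangent p) :
  clairaut g e v w = (clairaut_row g e v *m (clairaut_row g e w)^T) 0 0.
Proof. by rewrite mulmx_trE; apply: eq_bigr => i _; rewrite !mxE. Qed.

Lemma clairaut_diagE (R : realType) (n : nat) (G : lieGroupType R n)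
    (g : tensor2 G) (e : n.-tuple (tangent (1%g : G))) (p : G)
    (v : tangent p) :
  clairaut g e v v = \sum_i clairaut_row g e v 0 i ^+ 2.
Proof. by rewrite clairautE mulmx_trE. Qed.

Lemma right_invariant_field_sum (R : realType) (n : nat)
    (G : lieGroupType R n) (I : finType) (a : I -> R)
    (x : I -> tangent (1%g : G)) (p : G) :
  right_invariant_field (\sum_i a i *: x i) p =
  \sum_i a i *: right_invariant_field (x i) p.
Proof.
rewrite /right_invariant_field /tangent_map linear_sum.
by apply: eq_bigr => i _; rewrite linearZ.
Qed.

Lemma clairaut_form_sum (R : realType) (n : nat) (G : lieGroupType R n)
    (g : tensor2 G) (I : finType) (a : I -> R)
    (x : I -> tangent (1%g : G)) (p : G) (v : tangent p) :
  semi_riemannian g ->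
  clairaut_form g (\sum_i a i *: x i) v =
  \sum_i a i * clairaut_form g (x i) v.
Proof.
case=> gC glin _ _ _; rewrite /clairaut_form right_invariant_field_sum gC.
have g0 : g p v 0 = 0.
  have := glin p 1 0 0 v; rewrite scaler0 addr0 mul1r => g00.
  by apply: (addrI (g p v 0)); rewrite -g00 addr0.
elim/big_rec2: _ => [//|i y z _ <-].
by rewrite glin gC.
Qed.

(** The matrix on the right is the same at every point: this is the source of
    constants that hold on the whole group. *)
Lemma clairaut_row_transition (R : realType) (n : nat) (G : lieGroupType R n)
    (g : tensor2 G) (e e' : n.-tuple (tangent (1%g : G))) (M : 'M[R]_n) :
  semi_riemannian g ->
  (forall j, tnth e' j = \sum_(i < n) M i j *: tnth e i) ->
  forall (p : G) (v : tangent p),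
    clairaut_row g e' v = clairaut_row g e v *m M.
Proof.
move=> hg eM p v; apply/rowP => j; rewrite !mxE eM clairaut_form_sum//.
by apply: eq_bigr => i _; rewrite mxE mulrC.
Qed.

Lemma exists_transition_matrix (R : fieldType) (V : vectType R) (n : nat)
    (e e' : n.-tuple V) :
  basis_of fullv e ->
  exists M : 'M[R]_n, forall j, tnth e' j = \sum_(i < n) M i j *: tnth e i.
Proof.
move=> he; exists (\matrix_(i, j) coord e i (tnth e' j)) => j.
rewrite {1}(coord_basis he (memvf (tnth e' j))).
by apply: eq_bigr => i _; rewrite mxE (tnth_nth 0 e).
Qed.

Lemma clairaut_le (R : realType) (n : nat) (G : lieGroupType R n)
    (g : tensor2 G) (e e' : n.-tuple (tangent (1%g : G))) :
  semi_riemannian g -> basis_of fullv e ->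
  exists2 K : R, 0 < K & forall (p : G) (v : tangent p),
    clairaut g e' v v <= K * clairaut g e v v.
Proof.
move=> hg he; have [M eM] := exists_transition_matrix e' he.
set F := \sum_j \sum_i M i j ^+ 2.
have F0 : 0 <= F.
  by apply: sumr_ge0 => j _; apply: sumr_ge0 => i _; exact: sqr_ge0.
(* F alone vanishes when n = 0, and the constant has to be positive. *)
exists (1 + F) => [|p v]; first lra.
rewrite !clairaut_diagE (clairaut_row_transition hg eM).
apply: le_trans (mulmx_sqr_le _ _) _; apply: ler_wpM2r; last by rewrite lerDr.
by apply: sumr_ge0 => i _; exact: sqr_ge0.
Qed.

Lemma bilipschitz_bounded_of_le (R : realType) (n : nat)
    (M : smoothManifoldType R n) (h h' : tensor2 M) (K K' : R) :
  0 < K -> 0 < K' ->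
  (forall (p : M) (v : tangent p), 0 <= h p v v) ->
  (forall (p : M) (v : tangent p), h' p v v <= K * h p v v) ->
  (forall (p : M) (v : tangent p), h p v v <= K' * h' p v v) ->
  bilipschitz_bounded h h'.
Proof.
move=> K0 K'0 h0 hK hK'.
(* The inverse of any common upper bound of K and K' works on both sides. *)
exists (K + K')^-1 => [|p v]; first by rewrite invr_gt0 addr_gt0.
have h'0 : 0 <= h' p v v by rewrite -(pmulr_rge0 _ K'0) (le_trans (h0 p v)).
rewrite invrK ler_pdivrMl ?addr_gt0//; apply/andP; split.
  by rewrite (le_trans (hK' p v))// ler_wpM2r// lerDr ltW.
by rewrite (le_trans (hK p v))// mulrC ler_wpM2l// lerDl ltW.
Qed.

(** * Lengths and distances *)

(** Every simple function below f2 becomes, after division by k, a simple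
    function below f1, so the suprema that define the two integrals compare. *)
Lemma ge0_le_integral_scale d (T : measurableType d) (R : realType)
    (mu : {measure set T -> \bar R}) (D : set T) (f1 f2 : T -> \bar R)
    (k : R) :
  0 < k -> (forall x, D x -> (0 <= f1 x)%E) ->
  (forall x, D x -> (0 <= f2 x)%E) ->
  (forall x, D x -> (f2 x <= k%:E * f1 x)%E) ->
  (\int[mu]_(x in D) f2 x <= k%:E * \int[mu]_(x in D) f1 x)%E.
Proof.
move=> k0 f10 f20 f21; rewrite !ge0_integralE//.
apply: ge_ereal_sup => _ [h /= hf2 <-].
have ki0 : 0 <= k^-1 by rewrite invr_ge0 ltW.
rewrite -lee_pdivrMl// -sintegralrM.
apply: ereal_sup_ubound; exists (scale_nnsfun h ki0) => //= x.
rewrite EFinM lee_pdivrMl//; apply: le_trans (hf2 x) _.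
rewrite /patch; case: ifPn => [/set_mem /f21 //|_].
by rewrite mule0.
Qed.

Lemma curve_length_le (R : realType) (n : nat) (M : smoothManifoldType R n)
    (h h' : tensor2 M) (K : R) (c : R -> M) :
  0 < K ->
  (forall (p : M) (v : tangent p), h' p v v <= K * h p v v) ->
  (curve_length h' c <= (Num.sqrt K)%:E * curve_length h c)%E.
Proof.
move=> K0 hK; apply: ge0_le_integral_scale; rewrite ?sqrtr_gt0// => t _.
by rewrite -EFinM lee_fin -(sqrtrM _ (ltW K0)) ler_wsqrtr.
Qed.

Lemma riemannian_dist_uniformly_finer (R : realType) (n : nat)
    (M : smoothManifoldType R n) (h h' : tensor2 M) (K : R) :
  0 < K ->
  (forall (p : M) (v : tangent p), h' p v v <= K * h p v v) ->
  uniformly_finer (riemannian_dist h) (riemannian_dist h').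
Proof.
move=> K0 hK eps eps0.
have s0 : 0 < Num.sqrt K by rewrite sqrtr_gt0.
exists ((Num.sqrt K)^-1 * eps) => [|p q]; first by rewrite mulr_gt0 ?invr_gt0.
move=> /ereal_inf_lt[_ [c cpq <-]] clt.
apply: le_lt_trans (ereal_inf_lbound _) _; first by exists c.
apply: le_lt_trans (curve_length_le c K0 hK) _.
by rewrite -lte_pdivlMl.
Qed.

Theorem proposition2p4 (R : realType) (n : nat) (G : lieGroupType R n)
    (g : tensor2 G) (hg : semi_riemannian g) (hinv : left_invariant g)
    (e e' : n.-tuple (tangent (1%g : G)))
    (he : basis_of fullv e) (he' : basis_of fullv e') :
  [/\ bilipschitz_bounded (clairaut g e) (clairaut g e'),
      uniformly_equivalent (riemannian_dist (clairaut g e))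
                           (riemannian_dist (clairaut g e')) &
      forall M : 'M[R]_n,
        (forall j : 'I_n, tnth e' j = \sum_(i < n) M i j *: tnth e i) ->
        M^T *m M = 1%:M ->
        clairaut g e = clairaut g e'].
Proof.
have [K K0 hK] := clairaut_le e' hg he.
have [K' K'0 hK'] := clairaut_le e hg he'.
split.
- apply: bilipschitz_bounded_of_le K0 K'0 _ hK hK' => p v.
  by rewrite clairaut_diagE; apply: sumr_ge0 => i _; exact: sqr_ge0.
- by split; [exact: riemannian_dist_uniformly_finer hK
            |exact: riemannian_dist_uniformly_finer hK'].
move=> M eM MTM; apply: functional_extensionality_dep => p.
apply/funext => v; apply/funext => w.
rewrite !clairautE !(clairaut_row_transition hg eM) trmx_mul.
by rewrite mulmxA -(mulmxA _ M) (mulmx1C MTM) mulmx1.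
Qed.
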